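(* Let $F$ be a positive integer and let $S\subseteq\mathbb{N}$. The following conditions are equivalent. 1) $S\in\mathrm{Arf}(F)$ and the $\mathrm{Arf}(F)$-rank of $S$ is equal to $1$. 2) There is $m\in\mathbb{N}$ such that $2\le m<F$, $m\nmid F$ and $S=\langle m\rangle\cup\{n\in\mathbb{N}\mid n\ge F+1\}$.
   Context: $\mathbb{N}$ denotes the set of nonnegative integers, and $\langle m\rangle=\{\lambda m\mid\lambda\in\mathbb{N}\}$. A numerical semigroup is a subset $S\subseteq\mathbb{N}$ that contains $0$, is closed under addition, and has finite complement in $\mathbb{N}$. The Frobenius number $\mathrm{F}(S)$ is the greatest integer not in $S$. An A-semigroup (Arf numerical semigroup) is a numerical semigroup $S$ such that $x+y-z\in S$ for all $x,y,z\in S$ with $x\ge y\ge z$. $\mathrm{Arf}(F)$ is the set of A-semigroups with Frobenius number $F$; its minimum with respect to inclusion is $\Delta(F)=\{0\}\cup\{n\in\mathbb{N}\mid n\ge F+1\}$. A set $X$ is an $\mathrm{Arf}(F)$-set if $X\cap\Delta(F)=\emptyset$ and there is $S\in\mathrm{Arf}(F)$ such that $X\subseteq S$. For an $\mathrm{Arf}(F)$-set $X$, $\mathrm{Arf}(F)[X]$ denotes the intersection of all elements of $\mathrm{Arf}(F)$ containing $X$ (it is the smallest element of $\mathrm{Arf}(F)$ containing $X$). If $X$ is an $\mathrm{Arf}(F)$-set and $S=\mathrm{Arf}(F)[X]$, then $X$ is an $\mathrm{Arf}(F)$-system of generators of $S$; it is minimal if moreover $S\neq\mathrm{Arf}(F)[Y]$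 for all $Y\subsetneq X$. Every $S\in\mathrm{Arf}(F)$ has a unique minimal $\mathrm{Arf}(F)$-system of generators; its cardinality is the $\mathrm{Arf}(F)$-rank of $S$. *)

(* Defs.v *)
From mathcomp Require Import all_boot finmap.
From mathcomp Require Import boolp classical_sets functions cardinality.

Set Implicit Arguments.
Unset Strict Implicit.
Unset Printing Implicit Defensive.

Local Open Scope classical_set_scope.
Local Open Scope nat_scope.

Definition numerical_semigroup (S : set nat) : Prop :=
  [/\ S 0,
      forall x y, S x -> S y -> S (x + y)
    & finite_set (~` S)].

(* Since [z <= y], the truncated subtraction in [x + y - z] is the true one. *)
Definition A_semigroup (S : set nat) : Prop :=
  numerical_semigroup S /\
  forall x y z, S x -> S y -> S z -> z <= y -> y <= x -> S (x + y - z).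

(* [F] is the greatest integer outside [S]. Only natural [F] are covered, so
   that [S = setT], whose Frobenius number is -1, has none here. *)
Definition is_Frobenius_number (S : set nat) (F : nat) : Prop :=
  ~ S F /\ forall n, ~ S n -> n <= F.

Definition Arf (F : nat) : set (set nat) :=
  [set S | A_semigroup S /\ is_Frobenius_number S F].

Definition Delta (F : nat) : set nat := [set 0] `|` [set n | F + 1 <= n].

Definition Arf_set (F : nat) (X : set nat) : Prop :=
  X `&` Delta F = set0 /\ exists2 S, Arf F S & X `<=` S.

(* [smallest C X] is the intersection of all the members of [C] containing
   [X]. *)
Definition Arf_closure (F : nat) (X : set nat) : set nat :=
  smallest (Arf F) X.

Definition Arf_system_of_generators (F : nat) (S X : set nat) : Prop :=
  Arf_set F X /\ S = Arf_closure F X.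

Definition minimal_Arf_system_of_generators (F : nat) (S X : set nat) : Prop :=
  Arf_system_of_generators F S X /\
  forall Y : set nat, Y `<` X -> S <> Arf_closure F Y.

(* The minimal system of generators of [S], which exists and is unique for
   [S] in [Arf F]; [set0] is a junk value for the other sets [S]. *)
Definition Arf_msg (F : nat) (S : set nat) : set nat :=
  xget set0 [set X | minimal_Arf_system_of_generators F S X].

(* [fset_set] loses nothing for [S] in [Arf F]: the elements of an Arf(F)-set
   are at most [F], so that [Arf_msg F S] is finite. *)
Definition Arf_rank (F : nat) (S : set nat) : nat :=
  #|` fset_set (Arf_msg F S)|%fset.

Definition multiples (m : nat) : set nat := [set k * m | k in [set: nat]].

(* Main.v *)
Require Import Defs.
From mathcomp Require Import all_boot finmap.
From mathcomp Require Import boolp classical_sets functions cardinality.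
From mathcomp Require Import zify.

(** Two facts carry the proof.

    For [2 <= m < F] with [m] not dividing [F], the set
    [multiples m `|` [set n | F + 1 <= n]] is the least member of [Arf F]
    containing [m]: it belongs to [Arf F] ([Arf_multiplesU_tail]), and any
    member of [Arf F] containing [m] must contain the multiples of [m] and every
    integer above [F]. Hence it is the closure of [[set m]]
    ([Arf_closure_set1]).

    Removing from a member [S] of [Arf F] its least nonzero element [m] gives
    another member of [Arf F], as long as [m < F] ([Arf_setD1]). So no subset of
    [S] avoiding [m] generates [S], and every system of generators of [S]
    contains [m]. When [S] is the closure of [[set m]], minimality then leaves
    [[set m]] as the only minimal system of generators ([Arf_msg_set1]).

    Conversely, if the minimal system of generators has one element [m], the
    mere existence of a member of [Arf F] containing [m] forces [m] not to divide
    [F], because [F] would otherwise be a sum of copies of [m]; and [S] is the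
    closure of [[set m]]. *)

Local Open Scope classical_set_scope.
Local Open Scope nat_scope.

Lemma Arf_gt F S n : Arf F S -> F < n -> S n.
Proof.
move=> [_ [_ maxF]] ltFn; apply: contrapT => /maxF.
by rewrite leqNgt ltFn.
Qed.

Lemma Arf_multiples F S m : Arf F S -> S m -> multiples m `<=` S.
Proof.
move=> [[[S0 SD _] _] _] Sm _ [k _ <-].
by elim: k => [|k IHk]; [rewrite mul0n | rewrite mulSn; apply: SD].
Qed.

(** Closure under addition is the Arf condition with [z = 0], and the complement
    is finite because [F] bounds it, so neither has to be checked. *)
Lemma Arf_intro F (S : set nat) :
    S 0 ->
    (forall x y z, S x -> S y -> S z -> z <= y -> y <= x -> S (x + y - z)) ->
    ~ S F -> (forall n, F < n -> S n) ->
  Arf F S.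
Proof.
move=> S0 SA SF S_gt.
have maxF n : ~ S n -> n <= F by move=> Sn; rewrite leqNgt; apply/negP => /S_gt.
split; split=> //; split=> //.
  move=> x y Sx Sy; have [lexy|/ltnW leyx] := leqP x y.
    by rewrite addnC -[y + x]subn0; apply: SA.
  by rewrite -[x + y]subn0; apply: SA.
by apply: (@sub_finite_set _ _ `I_F.+1); [move=> n /maxF | exact: finite_II].
Qed.

Lemma Arf_multiplesU_tail F m :
  ~~ (m %| F) -> Arf F (multiples m `|` [set n | F + 1 <= n]).
Proof.
move=> mF; apply: Arf_intro.
- by left; exists 0.
- move=> x y z Sx Sy Sz lezy leyx.
  have [ltFx|lexF] := ltnP F x; first by right => /=; lia.
  (* All three elements are at most F here, hence multiples of m. *)
  have mult n : n <= x -> (multiples m `|` [set n | F + 1 <= n]) n -> m %| n.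
    by move=> lenx [[k _ <-]|/=]; [exact: dvdn_mull | lia].
  left; have /dvdnP[k ->] : m %| x + y - z.
    rewrite dvdn_sub ?dvdn_add //; try by apply: mult => //.
    by apply: mult => //; exact: leq_trans leyx.
  by exists k.
- by case=> [[k _ Fkm]|/=]; [rewrite -Fkm dvdn_mull in mF | rewrite addn1 ltnn].
- by move=> n ltFn; right; rewrite /= addn1.
Qed.

Lemma Arf_closure_set1 F m : ~~ (m %| F) ->
  Arf_closure F [set m] = multiples m `|` [set n | F + 1 <= n].
Proof.
move=> mF; apply/seteqP; split.
  apply: smallest_sub; first exact: Arf_multiplesU_tail.
  by move=> _ ->; left; exists 1; rewrite ?mul1n.
move=> n Tn T [ArfT /(_ _ erefl) Tm].
case: Tn => [|ltFn]; first exact: Arf_multiples ArfT Tm n.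
by apply: Arf_gt ArfT _; rewrite -addn1.
Qed.

(** Since [x <= x + y - z], an Arf combination of elements of [S] equal to [m]
    has [x <= m]. As [m] is the least nonzero element, [x] is [m] or [0], and
    [x = 0] would make [y], [z] and the combination [0] as well: only
    combinations that use [m] itself reach [m]. *)
Lemma Arf_setD1 F S m : Arf F S -> S m -> 0 < m < F ->
  (forall n, S n -> 0 < n -> m <= n) -> Arf F (S `\ m).
Proof.
move=> ArfS Sm /andP[m_gt0 ltmF] min_m; have [[[S0 _ _] SA] [SF _]] := ArfS.
apply: Arf_intro.
- by split=> // m0; rewrite -m0 in m_gt0.
- move=> x y z [Sx xNm] [Sy yNm] [Sz zNm] lezy leyx; split; first exact: SA.
  move=> /= xyz_m; have xm : x <> m := xNm; have ym : y <> m := yNm.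
  by case: (posnP x) => [|/(min_m _ Sx)]; lia.
- by case.
- move=> n ltFn; split; first exact: Arf_gt ArfS ltFn.
  by move=> /= nm; lia.
Qed.

Lemma Arf_generators_min F S m X : Arf F S -> S m -> 0 < m < F ->
  (forall n, S n -> 0 < n -> m <= n) ->
  X `<=` S -> S = Arf_closure F X -> X m.
Proof.
move=> ArfS Sm m_bd min_m XS SX; apply: contrapT => Xm.
have : (S `\ m) m; last by move=> [_ /(_ erefl)].
move: (Sm); rewrite {1}SX; apply: smallest_sub; first exact: Arf_setD1.
by move=> n Xn; split; [exact: XS | move=> /= nm; rewrite nm in Xn].
Qed.

Lemma Arf_set_finite F X : Arf_set F X -> finite_set X.
Proof.
move=> [XD _]; apply: (@sub_finite_set _ _ `I_F.+1); last exact: finite_II.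
move=> n Xn /=; rewrite ltnS leqNgt; apply/negP => ltFn.
have : (X `&` Delta F) n by split=> //; right; rewrite /= addn1.
by rewrite XD.
Qed.

Lemma Arf_msg_set1 F m : 2 <= m -> m < F -> ~~ (m %| F) ->
  Arf_msg F (multiples m `|` [set n | F + 1 <= n]) = [set m].
Proof.
move=> m_ge2 ltmF mF; set S := multiples m `|` _.
have ArfS : Arf F S by exact: Arf_multiplesU_tail.
have Sm : S m by left; exists 1; rewrite ?mul1n.
have clm : S = Arf_closure F [set m] by rewrite Arf_closure_set1.
have m_bd : 0 < m < F by rewrite ltmF andbT; exact: ltnW.
have min_m n : S n -> 0 < n -> m <= n.
  by case=> [[[|k] _ <-]|/=] //; [rewrite leq_pmull | lia].
apply: xget_unique.
  split; first split => //; first split.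
  - by apply/seteqP; split=> // n [/= ->] [|] /=; lia.
  - by exists S => // _ ->.
  - move=> Y [Ym NmY] SY; apply: NmY => _ ->.
    by apply: Arf_generators_min SY => //; move=> n /Ym ->.
move=> X [[[_ [T ArfT XT]] SX] min_X].
have XS : X `<=` S by rewrite SX; exact: sub_gen_smallest.
have Xm : X m by exact: Arf_generators_min SX.
apply: contrapT => XNm; apply: (min_X [set m]) => //.
by rewrite properEneq; split; [apply/eqP => /esym | move=> _ ->].
Qed.

Theorem proposition6p9 (F : nat) (hF : 0 < F) (S : set nat) :
  (Arf F S /\ Arf_rank F S = 1) <->
  (exists m : nat,
     [/\ 2 <= m, m < F, ~~ (m %| F)
       & S = multiples m `|` [set n | F + 1 <= n]]).
Proof.
split=> [[ArfS]|[m [m_ge2 ltmF mF ->]]]; last first.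
  split; first exact: Arf_multiplesU_tail.
  by rewrite /Arf_rank Arf_msg_set1 // fset_set1 cardfs1.
rewrite /Arf_rank /Arf_msg; case: xgetP => [X _ [[ArfX SX] _]|_]; last first.
  by rewrite fset_set0 cardfs0.
move=> /eqP/cardfs1P[m /(congr1 (fun A => [set` A]))].
rewrite fset_setK; last exact: Arf_set_finite ArfX.
rewrite set_fset1 => Xm; rewrite {}Xm in ArfX SX.
have [XD [T ArfT /(_ _ erefl) Tm]] := ArfX.
have NDm : ~ Delta F m by move=> Dm; have : set0 m by rewrite -XD.
have NTF : ~ T F by have [_ []] := ArfT.
have mF : ~~ (m %| F).
  apply/negP => /dvdnP[k Fkm]; apply: NTF.
  by apply: (Arf_multiples F T m ArfT Tm); exists k.
have m_neq0 : m <> 0 by move=> m0; apply: NDm; left.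
have m_neq1 : m <> 1 by move=> m1; rewrite m1 dvd1n in mF.
have m_neqF : m <> F by move=> mE; rewrite mE dvdnn in mF.
have m_leF : ~ F + 1 <= m by move=> ltFm; apply: NDm; right.
exists m; split=> //; [lia | lia |].
by rewrite SX Arf_closure_set1.
Qed.
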